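(* Let $q$ be an odd prime power and let $L$ be a line of $\mathrm{PG}(5,q)$ in the $K$-orbit $o_{8,2}$. Then the hyperplane-orbit distribution of $L$ is $OD_4(L)=\left[0,\,q^2+\frac{3q+1}{2},\,\frac{q+1}{2},\,q^3-q\right]$.
   Context: A point $(y_0,\dots,y_5)$ of $\mathrm{PG}(5,q)$ is identified with the nonzero symmetric matrix $\begin{bmatrix} y_0&y_1&y_2\\ y_1&y_3&y_4\\ y_2&y_4&y_5\end{bmatrix}$ up to scalar. $K\cong\mathrm{PGL}(3,q)$ acts by $M\mapsto AMA^T$, $A\in\mathrm{GL}(3,q)$. The orbit $o_{8,2}$ (defined only for $q$ odd) is the $K$-orbit of the line $\left\{\begin{bmatrix}x&0&0\\0&y&0\\0&0&-\delta y\end{bmatrix}:(x,y)\in\mathrm{PG}(1,q)\right\}$, where $\delta$ is a non-square in $\mathbb F_q$. Hyperplanes correspond to conics of $\mathrm{PG}(2,q)$ (nonzero quadratic forms up to scalar): $\sum_{0\le i\le j\le2}a_{ij}X_iX_j$ corresponds to $a_{00}Y_0+a_{01}Y_1+a_{02}Y_2+a_{11}Y_3+a_{12}Y_4+a_{22}Y_5=0$. $\mathcal H_1,\mathcal H_{2,r},\mathcal H_{2,i},\mathcal H_3$ are the sets of hyperplanes corresponding respectively to double lines (scalar multiples of squares of linear forms), pairs of distinct real lines (products of two non-proportional linear forms over $\mathbb F_q$), pairs of conjugate imaginary lines (scalar multiples of products of two non-proportional linear forms conjugate over $\mathbb F_{q^2}$), and non-singular conics (those with $4a_{00}a_{11}a_{22}+a_{01}a_{02}a_{12}-a_{00}a_{12}^2-a_{11}a_{02}^2-a_{22}a_{01}^2\ne0$).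 $OD_4(L)=[h_1,h_{2,r},h_{2,i},h_3]$ lists the numbers of hyperplanes in $\mathcal H_1,\mathcal H_{2,r},\mathcal H_{2,i},\mathcal H_3$ containing $L$. *)

(* Defs.v *)
From HB Require Import structures.
From mathcomp Require Import all_boot all_order all_fingroup all_algebra.
From mathcomp Require Import mpoly.

Set Implicit Arguments.
Unset Strict Implicit.
Unset Printing Implicit Defensive.

Import GRing.Theory.
Local Open Scope ring_scope.

(* Projective subspaces of PG(5,q) are the vector subspaces of F^6, so lines
   have vector dimension 2, hyperplanes have vector dimension 5, and incidence
   is inclusion. *)
HB.instance Definition _ (F : finFieldType) (vT : vectType F) :=
  CanIsCountable (@VectorInternalTheory.vs2mxK F vT).
HB.instance Definition _ (F : finFieldType) (vT : vectType F) :
  isFinite {vspace vT} := CanIsFinite (@VectorInternalTheory.vs2mxK F vT).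

(* Position, in (y_0, ..., y_5), of the (i, j) entry of the symmetric matrix;
   equivalently, position of X_i X_j in the list
   X_0^2, X_0X_1, X_0X_2, X_1^2, X_1X_2, X_2^2. *)
Definition sym_index (i j : 'I_3) : 'I_6 :=
  inord (nth 0 (nth [::] [:: [:: 0; 1; 2]; [:: 1; 3; 4]; [:: 2; 4; 5]] i) j)%N.

Definition sym_row (k : 'I_6) : 'I_3 := inord (nth 0 [:: 0; 0; 0; 1; 1; 2] k)%N.
Definition sym_col (k : 'I_6) : 'I_3 := inord (nth 0 [:: 0; 1; 2; 1; 2; 2] k)%N.

Section SymmetricMatrices.
Variable F : fieldType.
Implicit Types (y : 'rV[F]_6) (M A : 'M[F]_3) (L : {vspace 'rV[F]_6}).

Definition sym_mx y : 'M[F]_3 := \matrix_(i, j) y 0 (sym_index i j).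

Definition sym_coord M : 'rV[F]_6 := \row_k M (sym_row k) (sym_col k).

Definition K_act A y : 'rV[F]_6 := sym_coord (A *m sym_mx y *m A^T).

Lemma K_act_is_linear A : linear (K_act A).
Proof.
move=> a y z; rewrite /K_act.
have -> : sym_mx (a *: y + z) = a *: sym_mx y + sym_mx z.
  by apply/matrixP=> i j; rewrite !mxE.
rewrite mulmxDr mulmxDl -scalemxAr -scalemxAl.
by apply/rowP=> k; rewrite !mxE.
Qed.

HB.instance Definition _ A :=
  GRing.isLinear.Build F 'rV[F]_6 'rV[F]_6 _ (K_act A) (K_act_is_linear A).

Definition K_image A L : {vspace 'rV[F]_6} := (linfun (K_act A) @: L)%VS.

Lemma sym_mx_tr y : (sym_mx y)^T = sym_mx y.
Proof.
apply/matrixP=> i j; rewrite !mxE; congr (y 0 _).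
by case: i j => [[|[|[|//]]] ?] [[|[|[|//]]] ?].
Qed.

Lemma sym_mxK : cancel sym_mx sym_coord.
Proof.
move=> y; apply/rowP=> k; rewrite !mxE; congr (y 0 _); apply/val_inj.
rewrite /sym_index /sym_row /sym_col.
by case: k => [[|[|[|[|[|[|//]]]]]] ?]; rewrite /= !inordK.
Qed.

Lemma sym_coordK M : M^T = M -> sym_mx (sym_coord M) = M.
Proof.
move=> MT; apply/matrixP=> i j; rewrite !mxE.
have symM u v : M u v = M v u by rewrite -[in LHS]MT mxE.
rewrite /sym_index /sym_row /sym_col.
have E (k : 'I_3) n : n = k :> nat -> inord n = k by move=> ->; exact: inord_val.
case: i j => [[|[|[|//]]] i3] [[|[|[|//]]] j3]; rewrite /= !inordK //=;
  by [congr (M _ _); apply: E | rewrite symM; congr (M _ _); apply: E].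
Qed.

Lemma sym_mx_act A y : sym_mx (K_act A y) = A *m sym_mx y *m A^T.
Proof.
by apply: sym_coordK; rewrite !trmx_mul trmxK sym_mx_tr mulmxA.
Qed.

End SymmetricMatrices.

Definition nonsquare (F : finFieldType) (delta : F) : bool :=
  ~~ [exists z : F, delta == z ^+ 2].

Definition o82_mx (F : fieldType) (delta x y : F) : 'M[F]_3 :=
  diag_mx (\row_(k < 3) [:: x; y; - (delta * y)]`_k).

Definition o82_line (F : fieldType) (delta : F) : {vspace 'rV[F]_6} :=
  <<[:: sym_coord (o82_mx delta 1 0); sym_coord (o82_mx delta 0 1)]>>%VS.

Lemma o82_lineP (F : fieldType) (delta : F) (v : 'rV[F]_6) :
  v \in o82_line delta <-> exists x y, sym_mx v = o82_mx delta x y.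
Proof.
have combE x y : x *: sym_coord (o82_mx delta 1 0)
    + y *: sym_coord (o82_mx delta 0 1) = sym_coord (o82_mx delta x y).
  apply/rowP=> k; rewrite !mxE; case: (_ == _); rewrite ?mulr0n ?mulr0 ?addr0 //.
  case: (sym_row k) => [[|[|[|//]]] ?]; rewrite /= !mulr1n ?mulr1 ?mulr0 //.
  - by rewrite addr0.
  - by rewrite add0r.
  - by rewrite oppr0 mulr0 add0r mulrN mulrC.
rewrite /o82_line span_cons span_seq1; split.
  case/memv_addP=> _ /vlineP[x ->] [_ /vlineP[y ->] ->].
  exists x, y; rewrite combE sym_coordK // tr_diag_mx //.
case=> x [y E]; rewrite -[v]sym_mxK E -combE.
by apply: memv_add; apply: memvZ; apply: memv_line.
Qed.

Definition o82 (F : finFieldType) (delta : F) : {set {vspace 'rV[F]_6}} :=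
  [set K_image A (o82_line delta) | A in [pred A : 'M[F]_3 | A \in unitmx]].

(* A vector a : 'rV_6 lists the coefficients a_00, a_01, a_02, a_11, a_12, a_22
   of a ternary quadratic form. *)
Definition qform (R : comNzRingType) (a : 'rV[R]_6) : {mpoly R[3]} :=
  \sum_(i < 3) \sum_(j < 3 | (i <= j)%N) a 0 (sym_index i j) *: ('X_i * 'X_j).

Definition lform (R : comNzRingType) (u : 'rV[R]_3) : {mpoly R[3]} :=
  \sum_(i < 3) u 0 i *: 'X_i.

Definition proportional (R : finFieldType) (u v : 'rV[R]_3) : bool :=
  [exists c : R, (u == c *: v) || (v == c *: u)].

(* The hyperplane a_00 Y_0 + a_01 Y_1 + ... + a_22 Y_5 = 0. *)
Definition hyperplane (F : fieldType) (a : 'rV[F]_6) : {vspace 'rV[F]_6} :=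
  lker (linfun (mulmxr a^T : 'rV[F]_6 -> 'rV[F]_1)).

Lemma hyperplaneP (F : fieldType) (a y : 'rV[F]_6) :
  (y \in hyperplane a) = (\sum_(k < 6) a 0 k * y 0 k == 0).
Proof.
rewrite memv_ker lfunE /=; apply/eqP/eqP=> [/rowP/(_ 0)|E].
  by rewrite !mxE => E; rewrite -[RHS]E; apply: eq_bigr => k _; rewrite mxE mulrC.
apply/rowP=> i; rewrite ord1 !mxE -[RHS]E.
by apply: eq_bigr => k _; rewrite mxE mulrC.
Qed.

Section Conics.
Variable F : finFieldType.
Implicit Types a : 'rV[F]_6.

Definition double_line a : bool :=
  (a != 0) && [exists c : F, exists u : 'rV[F]_3,
    qform a == c *: (lform u ^+ 2)].

Definition real_line_pair a : bool :=
  (a != 0) && [exists u : 'rV[F]_3, exists v : 'rV[F]_3,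
    ~~ proportional u v && (qform a == lform u * lform v)].

(* When iota embeds F in a field E of order #|F|^2, x |-> x^#|F| is the
   non-trivial automorphism of E over iota(F). *)
Definition conj_form (E : finFieldType) (u : 'rV[E]_3) : 'rV[E]_3 :=
  map_mx (fun x => x ^+ #|F|) u.

Definition imaginary_line_pair (E : finFieldType) (iota : {rmorphism F -> E}) a
    : bool :=
  (a != 0) && [exists c : F, exists u : 'rV[E]_3,
    ~~ proportional u (conj_form u) &&
    (map_mpoly iota (qform a) == iota c *: (lform u * lform (conj_form u)))].

Definition conic_disc a : F :=
  let a00 := a 0 (sym_index 0 0) in let a01 := a 0 (sym_index 0 1) in
  let a02 := a 0 (sym_index 0 2%:R) in let a11 := a 0 (sym_index 1 1) in
  let a12 := a 0 (sym_index 1 2%:R) in let a22 := a 0 (sym_index 2%:R 2%:R) in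
  4%:R * a00 * a11 * a22 + a01 * a02 * a12
    - a00 * a12 ^+ 2 - a11 * a02 ^+ 2 - a22 * a01 ^+ 2.

Definition nonsingular_conic a : bool := (a != 0) && (conic_disc a != 0).

Definition hyperplanes_of (P : pred 'rV[F]_6) : {set {vspace 'rV[F]_6}} :=
  [set hyperplane a | a in [pred a | P a]].

Definition num_through (L : {vspace 'rV[F]_6}) (S : {set {vspace 'rV[F]_6}})
    : nat :=
  #|[set H in S | (L <= H)%VS]|.

Definition OD4 (E : finFieldType) (iota : {rmorphism F -> E})
    (L : {vspace 'rV[F]_6}) : seq nat :=
  [:: num_through L (hyperplanes_of double_line);
      num_through L (hyperplanes_of real_line_pair);
      num_through L (hyperplanes_of (imaginary_line_pair iota));
      num_through L (hyperplanes_of nonsingular_conic)].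

End Conics.

(* Main.v *)
(* The hyperplanes through [o82_line delta] are the conics
   [b X0X1 + c X0X2 + delta d X1^2 + e X1X2 + d X2^2].  Such a conic passes through
   (1,0,0); it is non-singular iff [b c e <> d (b^2 + delta c^2)].  A singular one
   with (b,c) nonzero cannot be an imaginary pair, whose only rational point would
   be (1,0,0), and it splits explicitly.  When b = c = 0 it is a binary form of
   discriminant [e^2 - 4 delta d^2], which never vanishes as [delta] is a
   non-square: real pair or imaginary pair according to whether this is a square.
   A general line of the orbit is reached by pulling conics back along the
   collineation, and vectors are counted instead of hyperplanes, each hyperplane
   having q - 1 equations. *)
Require Import Defs.
From HB Require Import structures.
From mathcomp Require Import all_boot all_order all_fingroup all_algebra.
From mathcomp Require Import mpoly finfield ring zify.

Set Implicit Arguments.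
Unset Strict Implicit.
Unset Printing Implicit Defensive.

Import GRing.Theory.
Local Open Scope ring_scope.

(** * Squares in finite fields *)

(** Double counting along a map with fibres of constant size; it serves squaring, the passage from
    equations to hyperplanes, and [s + delta / s]. *)
Lemma card_imset_fibre (T T' : finType) (f : T -> T') (D : {set T}) (k : nat) :
    {in D, forall x, #|[set y in D | f y == f x]| = k} ->
  #|D| = (#|f @: D| * k)%N.
Proof.
move=> fib; rewrite -sum1_card (partition_big_imset f) -sum_nat_const /=.
apply: eq_bigr => _ /imsetP[x xD ->]; rewrite -(fib x xD) -sum1_card.
by apply: eq_bigl => y; rewrite inE.
Qed.

(** In characteristic 2 the order of the field would be a power of 2 greater than 1. *)
Lemma natr2_neq0 (F : finFieldType) : odd #|F| -> 2%:R != 0 :> F.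
Proof.
move=> oddF; apply/eqP=> two0.
have ch2 : 2 \in [pchar F] by rewrite inE /= two0 eqxx.
have := card_pprimeChar ch2; rewrite /pPrimeCharType /= => cF.
have := finNzRing_gt1 F; move: oddF; rewrite cF.
by case: (logn _ _) => [|n] //; rewrite oddX.
Qed.

Section Squares.
Variable F : finFieldType.
Hypothesis oddF : odd #|F|.
Let two0 : 2%:R != 0 :> F := natr2_neq0 oddF.

Lemma oppr_neq (x : F) : x != 0 -> - x != x.
Proof.
move=> x0; apply: contra_neq x0 => xN; apply/eqP.
have: 2%:R * x == 0 by rewrite mulr_natl mulr2n -{1}xN addNr.
by rewrite mulf_eq0 (negPf two0).
Qed.

(** Squaring on the nonzero elements has the two-element fibres [{x, - x}]. *)
Lemma card_sqr_nonzero :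
  #|F|.-1 = #|[set x ^+ 2 | x in [set~ (0 : F)]]|.*2.
Proof.
rewrite -(cardsC1 (0 : F)) -muln2; apply: card_imset_fibre => x; rewrite in_setC1 => x0.
transitivity #|[set x; - x]|; last by rewrite cards2 eq_sym oppr_neq.
apply: eq_card => y; rewrite !inE eqf_sqr.
have [->|_] := eqVneq y x; first by rewrite x0.
by have [->|_] := eqVneq y (- x); rewrite ?oppr_eq0 ?x0 ?andbF.
Qed.

Lemma nonsquareP (x : F) :
  reflect (forall z, x <> z ^+ 2) (nonsquare x).
Proof.
rewrite /nonsquare negb_exists.
by apply: (iffP forallP) => H z; apply/eqP.
Qed.

Lemma nonsquare_neq0 (x : F) : nonsquare x -> x != 0.
Proof.
by move=> /nonsquareP xN; apply/eqP=> x0; case: (xN 0); rewrite x0 expr0n.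
Qed.

(* The nonzero squares and their translate by [y] are disjoint and each is half
   of the nonzero elements. *)
Lemma nonsquare_ratio (x y : F) :
  nonsquare x -> nonsquare y -> exists z, x = y * z ^+ 2.
Proof.
move=> xN yN; have x0 := nonsquare_neq0 xN; have y0 := nonsquare_neq0 yN.
set S := [set z ^+ 2 | z in [set~ (0 : F)]].
have cS := card_sqr_nonzero; rewrite -/S in cS.
set U := [set y * s | s in S].
have cU : #|U| = #|S| by apply: card_imset; apply: mulfI.
have dSU : [disjoint S & U].
  (* A common element [z ^+ 2 = y * t ^+ 2] would make [y] the square of [z / t]. *)
  apply/pred0P=> s /=; apply/negP=> /andP[/imsetP[z z0 ->] /imsetP[_ /imsetP[t t0 ->] e]].
  move/nonsquareP: yN => /(_ (z / t)); apply; rewrite expr_div_n e mulfK //.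
  by rewrite expf_eq0 /=; rewrite in_setC1 in t0.
have /setP/(_ x) : S :|: U = [set~ 0].
  apply/eqP; rewrite eqEcard; apply/andP; split.
    apply/subsetP=> s; rewrite in_setC1.
    by case/setUP=> [/imsetP[z + ->]|/imsetP[_ /imsetP[z + ->] ->]];
      rewrite in_setC1 => z0; rewrite ?mulf_neq0 ?expf_neq0.
  rewrite cardsC1 cS cardsU (disjoint_setI0 dSU) cards0 cU subn0.
  by rewrite addnn.
rewrite in_setC1 x0 inE => /orP[/imsetP[z _ xE]|/imsetP[_ /imsetP[t _ ->] ->]].
  by move/nonsquareP: xN => /(_ z).
by exists t.
Qed.

End Squares.

(** * The Frobenius map of the quadratic extension *)

Section QuadraticExtension.
Variables (F E : finFieldType) (iota : {rmorphism F -> E}).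

Lemma rmorph_card x : iota x ^+ #|F| = iota x.
Proof. by rewrite -rmorphXn expf_card. Qed.

(** The order of [F] is a power of its characteristic, which [E] shares through [iota]. *)
Lemma exprD_card (x y : E) : (x + y) ^+ #|F| = x ^+ #|F| + y ^+ #|F|.
Proof.
have [p p_pr chF] := finPcharP F.
have -> := card_pprimeChar chF.
by apply: exprDn_pchar; rewrite pnatX pnatE // (rmorph_pchar iota chF).
Qed.

Lemma exprN_card (x : E) : (- x) ^+ #|F| = - x ^+ #|F|.
Proof.
apply/eqP; rewrite -addr_eq0 -exprD_card addNr expr0n.
by rewrite -leqn0 leqNgt (ltn_trans _ (finNzRing_gt1 F)).
Qed.

Hypothesis oddF : odd #|F|.
Hypothesis cardE : #|E| = (#|F| ^ 2)%N.

Lemma exprK_card (x : E) : (x ^+ #|F|) ^+ #|F| = x.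
Proof. by rewrite -exprM mulnn -cardE expf_card. Qed.

(** The polynomial ['X^#|F| - 'X] has at most [#|F|] roots, and the image of [iota] already supplies
    that many. *)
Lemma fixed_card (x : E) : x ^+ #|F| = x -> exists y, x = iota y.
Proof.
move=> xq; have q1 := finNzRing_gt1 F.
have [/codomP[y ->]|xn] := boolP (x \in codom iota); first by exists y.
pose p : {poly E} := 'X^#|F| - 'X.
have sp : size p = #|F|.+1 by rewrite size_polyDl ?size_polyXn // size_polyN size_polyX.
have := @max_poly_roots _ p (x :: codom iota).
rewrite -size_poly_eq0 sp /= size_codom ltnn => H; exfalso; suff: false by []; apply: H => //.
  rewrite /root !hornerE xq subrr eqxx /=; apply/allP=> _ /codomP[y ->].
  by rewrite /root !hornerE rmorph_card subrr.
by rewrite xn /= map_inj_uniq ?enum_uniq //; apply: fmorph_inj.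
Qed.

Lemma exists_moved : exists z : E, z ^+ #|F| != z.
Proof.
apply/existsP; rewrite -negb_forall; apply/negP=> /forallP fixE.
suff : (#|E| <= #|F|)%N.
  by rewrite cardE leqNgt -{1}(expn1 #|F|) ltn_exp2l ?finNzRing_gt1.
rewrite -(card_codom (fmorph_inj iota)); apply/subset_leq_card/subsetP=> x _.
by have [y ->] := fixed_card (eqP (fixE x)); apply: codom_f.
Qed.

(* For [z] moved by Frobenius, [t = z ^+ q - z] is anti-invariant, so [t ^+ 2]
   is a non-square of [F]; any other one differs from it by a square. *)
Lemma nonsquare_sqrt (n : F) : nonsquare n ->
  exists w : E, [/\ w != 0, w ^+ 2 = iota n & w ^+ #|F| = - w].
Proof.
move=> nN; have [z zq] := exists_moved; have oddE : odd #|E| by rewrite cardE oddX oddF orbT.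
set t := z ^+ #|F| - z.
have t0 : t != 0 by rewrite subr_eq0.
have tq : t ^+ #|F| = - t by rewrite exprD_card exprN_card exprK_card opprB addrC.
have [m mE] : exists m, t ^+ 2 = iota m.
  by apply: fixed_card; rewrite exprAC tq sqrrN.
have mN : nonsquare m.
  (* If [m = s ^+ 2], then [t] is [iota s] or its opposite, hence fixed by Frobenius, whereas
     Frobenius negates [t] and [t] is nonzero. *)
  apply/nonsquareP=> s ms; move: mE; rewrite ms rmorphXn => /eqP.
  rewrite eqf_sqr => /orP[] /eqP ts; have := oppr_neq oddE t0; rewrite -tq ts.
    by rewrite rmorph_card eqxx.
  by rewrite exprN_card rmorph_card eqxx.
have [s sE] := nonsquare_ratio oddF nN mN.
exists (t * iota s); split.
- rewrite mulf_neq0 // fmorph_eq0; apply: contraTneq nN => s0.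
  by rewrite sE s0 expr0n mulr0; apply/nonsquareP=> /(_ 0); rewrite expr0n.
- by rewrite exprMn mE sE rmorphM rmorphXn.
- by rewrite exprMn tq rmorph_card mulNr.
Qed.

End QuadraticExtension.

(** * Coefficients and polar matrices of ternary quadratic forms *)

Lemma sum3E (V : nmodType) (f : 'I_3 -> V) : \sum_i f i = f 0 + f 1 + f 2%:R.
Proof.
rewrite !big_ord_recl big_ord0 addr0 addrA.
by congr (f _ + f _ + f _); apply: val_inj.
Qed.

Lemma det3E (R : comNzRingType) (M : 'M[R]_3) :
  \det M = M 0 0 * (M 1 1 * M 2%:R 2%:R - M 1 2%:R * M 2%:R 1)
    - M 0 1 * (M 1 0 * M 2%:R 2%:R - M 1 2%:R * M 2%:R 0)
    + M 0 2%:R * (M 1 0 * M 2%:R 1 - M 1 1 * M 2%:R 0).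
Proof.
pose m i j := M (inord i) (inord j).
have mE i j : M i j = m i j by rewrite /m !inord_val.
rewrite (expand_det_row _ ord0) !big_ord_recl big_ord0 /cofactor.
do 2! rewrite !(expand_det_row _ ord0) !big_ord_recl !big_ord0 /cofactor.
rewrite !det_mx00 !mxE !mE /= /bump /=.
by ring.
Qed.

Section Coordinates.
Variable R : nzRingType.
Implicit Types a b : 'rV[R]_6.

Lemma eq_sym6 a b :
    a 0 (sym_index 0 0) = b 0 (sym_index 0 0) ->
    a 0 (sym_index 0 1) = b 0 (sym_index 0 1) ->
    a 0 (sym_index 0 2%:R) = b 0 (sym_index 0 2%:R) ->
    a 0 (sym_index 1 1) = b 0 (sym_index 1 1) ->
    a 0 (sym_index 1 2%:R) = b 0 (sym_index 1 2%:R) ->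
    a 0 (sym_index 2%:R 2%:R) = b 0 (sym_index 2%:R 2%:R) ->
  a = b.
Proof.
move=> e00 e01 e02 e11 e12 e22; apply/rowP=> k.
have sI i j : a 0 (sym_index i j) = b 0 (sym_index i j) ->
  sym_index i j == k :> nat -> a 0 k = b 0 k by move=> + /eqP/val_inj <-.
by case: k sI => [[|[|[|[|[|[|//]]]]]] k6] sI;
  [apply: (sI _ _ e00)|apply: (sI _ _ e01)|apply: (sI _ _ e02)
  |apply: (sI _ _ e11)|apply: (sI _ _ e12)|apply: (sI _ _ e22)];
  rewrite inordK.
Qed.

End Coordinates.
Section Forms.
Variable F : fieldType.
Implicit Types (a b : 'rV[F]_6) (u v : 'rV[F]_3) (M A : 'M[F]_3).

Lemma sym_coordE M i j : M^T = M -> sym_coord M 0 (sym_index i j) = M i j.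
Proof. by move=> MT; rewrite -[in RHS](sym_coordK MT) [RHS]mxE. Qed.

(** Coefficient vector of the product of two linear forms; it lets the types of conics be handled on
    vectors instead of polynomials. *)
Definition line_pair u v : 'rV[F]_6 :=
  sym_coord (\matrix_(i, j)
    if i == j then u 0 i * v 0 i else u 0 i * v 0 j + u 0 j * v 0 i).

Lemma line_pairE u v i j : line_pair u v 0 (sym_index i j) =
  if i == j then u 0 i * v 0 i else u 0 i * v 0 j + u 0 j * v 0 i.
Proof.
rewrite sym_coordE ?mxE //; apply/matrixP=> k l; rewrite !mxE eq_sym.
by case: eqP => [->|] //; rewrite addrC.
Qed.

Lemma line_pairZl c u v : line_pair (c *: u) v = c *: line_pair u v.
Proof. by apply: eq_sym6; rewrite [RHS]mxE !line_pairE /= !mxE; ring. Qed.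

Lemma qform3E a : qform a =
  a 0 (sym_index 0 0) *: ('X_0 * 'X_0) + a 0 (sym_index 0 1) *: ('X_0 * 'X_1)
  + a 0 (sym_index 0 2%:R) *: ('X_0 * 'X_2%:R)
  + a 0 (sym_index 1 1) *: ('X_1 * 'X_1)
  + a 0 (sym_index 1 2%:R) *: ('X_1 * 'X_2%:R)
  + a 0 (sym_index 2%:R 2%:R) *: ('X_2%:R * 'X_2%:R).
Proof.
rewrite /qform sum3E; do 3! rewrite [\sum_(j < 3 | _) _]big_mkcond sum3E /=.
by rewrite !addr0 !add0r !addrA.
Qed.

Lemma meval_qform a (x : 'I_3 -> F) : (qform a).@[x] =
  a 0 (sym_index 0 0) * (x 0 * x 0) + a 0 (sym_index 0 1) * (x 0 * x 1)
  + a 0 (sym_index 0 2%:R) * (x 0 * x 2%:R)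
  + a 0 (sym_index 1 1) * (x 1 * x 1)
  + a 0 (sym_index 1 2%:R) * (x 1 * x 2%:R)
  + a 0 (sym_index 2%:R 2%:R) * (x 2%:R * x 2%:R).
Proof. by rewrite qform3E !mevalD !mevalZ !mevalM !mevalXU. Qed.

(** Values at the three basis points give the square coefficients; values at their pairwise sums
    then give the mixed ones. *)
Lemma qform_inj : injective (@qform F).
Proof.
move=> a b eab.
have ev (s : seq F) := congr1 (meval (fun i : 'I_3 => s`_i)) eab.
have e0 := ev [:: 1; 0; 0]; have e1 := ev [:: 0; 1; 0]; have e2 := ev [:: 0; 0; 1].
have e01 := ev [:: 1; 1; 0]; have e02 := ev [:: 1; 0; 1]; have e12 := ev [:: 0; 1; 1].
move: e0 e1 e2 e01 e02 e12.
rewrite !meval_qform /=.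
rewrite !(mulr0, mul0r, mulr1, addr0, add0r).
move=> e0 e1 e2; rewrite e0 e1 e2 => /addIr/addrI e01 /addIr/addrI e02 /addIr/addrI e12.
exact: eq_sym6.
Qed.

Lemma qformZ c a : qform (c *: a) = c *: qform a.
Proof. by rewrite !qform3E !mxE !scalerDr !scalerA. Qed.

Lemma qform_line_pair u v : qform (line_pair u v) = lform u * lform v.
Proof.
rewrite qform3E !line_pairE /= /lform !sum3E.
rewrite -!mul_mpolyC !(mpolyCD, mpolyCM); ring.
Qed.

End Forms.

Lemma map_qform (F E : fieldType) (iota : {rmorphism F -> E}) (a : 'rV[F]_6) :
  map_mpoly iota (qform a) = qform (map_mx iota a).
Proof.
by rewrite !qform3E !mxE !rmorphD /= !map_mpolyZ !rmorphM /= !map_mpolyX.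
Qed.

Section ConicTypes.
Variables (F : finFieldType).
Implicit Types a : 'rV[F]_6.

Lemma double_lineP a : reflect (a != 0 /\ exists c u, a = c *: line_pair u u)
  (double_line a).
Proof.
apply: (iffP andP) => -[a0 H]; split=> //.
  case/existsP: H => c /existsP[u /eqP e]; exists c, u; apply: qform_inj.
  by rewrite qformZ qform_line_pair.
case: H => c [u ->]; apply/existsP; exists c; apply/existsP; exists u.
by rewrite qformZ qform_line_pair.
Qed.

Lemma real_line_pairP a :
  reflect (a != 0 /\ exists u v, ~~ proportional u v /\ a = line_pair u v)
    (real_line_pair a).
Proof.
apply: (iffP andP) => -[a0 H]; split=> //.
  case/existsP: H => u /existsP[v /andP[uv /eqP e]]; exists u, v; split=> //.
  by apply: qform_inj; rewrite qform_line_pair.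
case: H => u [v [uv ->]]; apply/existsP; exists u; apply/existsP; exists v.
by rewrite uv qform_line_pair /=.
Qed.

Lemma imaginary_line_pairP (E : finFieldType) (iota : {rmorphism F -> E}) a :
  reflect (a != 0 /\ exists c u, ~~ proportional u (conj_form F u) /\
      map_mx iota a = iota c *: line_pair u (conj_form F u))
    (imaginary_line_pair iota a).
Proof.
apply: (iffP andP) => -[a0 H]; split=> //.
  case/existsP: H => c /existsP[u /andP[uv /eqP e]]; exists c, u; split=> //.
  by apply: qform_inj; rewrite -map_qform qformZ qform_line_pair.
case: H => c [u [uv e]]; apply/existsP; exists c; apply/existsP; exists u.
by rewrite uv /= map_qform e qformZ qform_line_pair.
Qed.

End ConicTypes.

Lemma sum_sym_index (V : nmodType) (f : 'I_6 -> V) :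
  \sum_k f k = f (sym_index 0 0) + f (sym_index 0 1) + f (sym_index 0 2%:R)
    + f (sym_index 1 1) + f (sym_index 1 2%:R) + f (sym_index 2%:R 2%:R).
Proof.
rewrite !big_ord_recl big_ord0 addr0 !addrA.
by congr (f _ + f _ + f _ + f _ + f _ + f _); apply: val_inj; rewrite /= inordK.
Qed.

(** * Pullback of conics and its duality with the action on points *)

Section Polarity.
Variable F : fieldType.
Implicit Types (a y : 'rV[F]_6) (u v : 'rV[F]_3) (M A B : 'M[F]_3).

(* Twice the Gram matrix of the form [a]; it determines [a] in odd characteristic. *)
Definition polar_mx a : 'M[F]_3 :=
  \matrix_(i, j) (a 0 (sym_index i j) *+ (i == j).+1).

(** Halving the diagonal undoes [polar_mx] when 2 is invertible. *)
Definition polar_coord M : 'rV[F]_6 :=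
  sym_coord (\matrix_(i, j) (M i j / (i == j).+1%:R)).

(** The form [a] composed with the substitution [x |-> A x] on column vectors, computed by
    congruence of polar matrices. *)
Definition pullback A a : 'rV[F]_6 := polar_coord (A^T *m polar_mx a *m A).

Lemma sym_indexC i j : sym_index i j = sym_index j i.
Proof.
by case: i j => [[|[|[|//]]] ?] [[|[|[|//]]] ?].
Qed.

Lemma polar_mx_tr a : (polar_mx a)^T = polar_mx a.
Proof. by apply/matrixP=> i j; rewrite !mxE sym_indexC eq_sym. Qed.

Lemma polar_mxZ c a : polar_mx (c *: a) = c *: polar_mx a.
Proof. by apply/matrixP=> i j; rewrite !mxE mulrnAr. Qed.

Lemma polar_line_pair u v :
  polar_mx (line_pair u v) = u^T *m v + v^T *m u.
Proof.
apply/matrixP=> i j; rewrite [LHS]mxE line_pairE !mxE !big_ord1 !mxE [v 0 i * _]mulrC.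
by case: eqP => [->|_]; rewrite ?mulr1n // mulr2n [v 0 j * _]mulrC.
Qed.

(** Off-diagonal terms occur twice in the trace and [polar_mx] doubles the diagonal ones. Incidence
    thus becomes a trace, on which congruences are easy to move. *)
Lemma mxtrace_polar a y :
  \tr (polar_mx a *m sym_mx y) = 2%:R * \sum_k a 0 k * y 0 k.
Proof.
rewrite sum_sym_index /mxtrace sum3E !mxE !sum3E !mxE.
by rewrite (sym_indexC 1 0) (sym_indexC 2%:R 0) (sym_indexC 2%:R 1) /=; ring.
Qed.

Hypothesis two0 : 2%:R != 0 :> F.

Lemma polar_mxK : cancel polar_mx polar_coord.
Proof.
move=> a; rewrite -[RHS]sym_mxK; congr sym_coord; apply/matrixP=> i j.
by rewrite !mxE; case: (i == j); rewrite /= ?mulr1n ?divr1 // -[a 0 _ *+ 2]mulr_natr mulfK.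
Qed.

Lemma polar_coordK M : M^T = M -> polar_mx (polar_coord M) = M.
Proof.
move=> MT; apply/matrixP=> i j; rewrite [LHS]mxE sym_coordE.
  by rewrite mxE; case: (i == j); rewrite /= ?mulr1n ?divr1 // -[_ / _ *+ 2]mulr_natr divfK.
by apply/matrixP=> k l; rewrite !mxE -[in RHS]MT mxE eq_sym.
Qed.

Lemma polar_pullback A a :
  polar_mx (pullback A a) = A^T *m polar_mx a *m A.
Proof.
by rewrite polar_coordK // !trmx_mul trmxK polar_mx_tr mulmxA.
Qed.

Lemma pullback_line_pair A u v :
  pullback A (line_pair u v) = line_pair (u *m A) (v *m A).
Proof.
apply: (can_inj polar_mxK); rewrite polar_pullback !polar_line_pair.
by rewrite mulmxDr mulmxDl !trmx_mul !mulmxA.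
Qed.

Lemma pullbackZ A c a : pullback A (c *: a) = c *: pullback A a.
Proof.
apply: (can_inj polar_mxK); rewrite polar_mxZ !polar_pullback polar_mxZ.
by rewrite -scalemxAr -scalemxAl.
Qed.

Lemma pullbackK A : A \in unitmx -> cancel (pullback A) (pullback (invmx A)).
Proof.
move=> uA a; apply: (can_inj polar_mxK); rewrite !polar_pullback !mulmxA.
by rewrite -trmx_mul mulmxV // trmx1 mul1mx mulmxK.
Qed.

Lemma pullback_eq0 A a : A \in unitmx -> (pullback A a == 0) = (a == 0).
Proof.
move=> uA; rewrite -(inj_eq (can_inj (pullbackK uA)) a 0); congr (_ == _).
by rewrite -[in RHS](scale0r (0 : 'rV_6)) pullbackZ scale0r.
Qed.

(** Cyclicity of the trace makes [pullback A] adjoint to [K_act A]; the factor 2 on both sides is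
    cancelled. *)
Lemma pullback_dot A a y :
  \sum_k pullback A a 0 k * y 0 k = \sum_k a 0 k * K_act A y 0 k.
Proof.
apply: (mulfI two0); rewrite -!mxtrace_polar polar_pullback sym_mx_act.
by rewrite !mulmxA [RHS]mxtrace_mulC !mulmxA.
Qed.

Lemma sub_hyperplaneP (L : {vspace 'rV[F]_6}) a :
  reflect (forall y, y \in L -> \sum_k a 0 k * y 0 k = 0) (L <= hyperplane a)%VS.
Proof.
apply: (iffP subvP) => H y /H; first by rewrite hyperplaneP => /eqP.
by rewrite hyperplaneP => ->.
Qed.

Lemma sub_hyperplane_image A a (L : {vspace 'rV[F]_6}) :
  (K_image A L <= hyperplane a)%VS = (L <= hyperplane (pullback A a))%VS.
Proof.
apply/sub_hyperplaneP/sub_hyperplaneP => H y yL.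
  by rewrite pullback_dot H // -[K_act _ _]lfunE memv_img.
by case/memv_imgP: yL => z zL ->; rewrite lfunE -pullback_dot H.
Qed.

End Polarity.

Lemma map_polar_mx (F E : fieldType) (iota : {rmorphism F -> E}) (a : 'rV[F]_6) :
  map_mx iota (polar_mx a) = polar_mx (map_mx iota a).
Proof. by apply/matrixP=> i j; rewrite !mxE rmorphMn. Qed.

Lemma map_pullback (F E : fieldType) (iota : {rmorphism F -> E}) A (a : 'rV[F]_6) :
    2%:R != 0 :> F ->
  map_mx iota (pullback A a) = pullback (map_mx iota A) (map_mx iota a).
Proof.
move=> two0; have two0E : 2%:R != 0 :> E by rewrite -(rmorph_nat iota) fmorph_eq0.
apply: (can_inj (polar_mxK two0E)); rewrite -map_polar_mx !polar_pullback //.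
by rewrite !map_mxM map_trmx map_polar_mx.
Qed.

Lemma eq_hyperplane (F : fieldType) (a b : 'rV[F]_6) :
  a != 0 -> b != 0 -> (hyperplane a == hyperplane b) <-> exists2 c, c != 0 & a = c *: b.
Proof.
move=> a0 b0; split=> [/eqP ab|[c c0 ->]].
  (* The columns of [cokermx b] lie in the common hyperplane, so [a] kills them and therefore
     belongs to the row space of [b]. *)
  have /sub_rVP[c ac] : (a <= b)%MS.
    rewrite submxE; apply/eqP/rowP=> j; rewrite !mxE.
    have : (col j (cokermx b))^T \in hyperplane b.
      rewrite hyperplaneP; have /rowP/(_ j) := mulmx_coker b; rewrite !mxE => e.
      by apply/eqP; rewrite -[RHS]e; apply: eq_bigr => k _; rewrite !mxE.
    rewrite -ab hyperplaneP => /eqP e.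
    by rewrite -[RHS]e; apply: eq_bigr => k _; rewrite !mxE.
  by exists c => //; apply: contraNneq a0 => c0; rewrite ac c0 scale0r.
apply/eqP/vspaceP=> y; rewrite !hyperplaneP.
under eq_bigr do rewrite mxE -mulrA.
by rewrite -mulr_sumr mulf_eq0 (negPf c0).
Qed.

(** * Invariance under pullback and hyperplane counts *)

Section Invariance.
Variables (F E : finFieldType) (iota : {rmorphism F -> E}).
Hypothesis oddF : odd #|F|.
Let two0 : 2%:R != 0 :> F := natr2_neq0 oddF.
Implicit Types (a : 'rV[F]_6) (A : 'M[F]_3) (c : F).

(** This turns non-singularity into a determinant condition, which congruence and scaling visibly
    preserve. *)
Lemma two_conic_disc a : 2%:R * conic_disc a = \det (polar_mx a).
Proof.
rewrite det3E !mxE /conic_disc.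
by rewrite (sym_indexC 1 0) (sym_indexC 2%:R 0) (sym_indexC 2%:R 1) /=; ring.
Qed.

Lemma nonsingular_conicE a :
  nonsingular_conic a = (a != 0) && (\det (polar_mx a) != 0).
Proof. by rewrite -two_conic_disc mulf_eq0 (negPf two0). Qed.

Lemma proportional_mulmx (K : finFieldType) (B : 'M[K]_3) (u v : 'rV[K]_3) :
  B \in unitmx -> proportional (u *m B) (v *m B) = proportional u v.
Proof.
move=> uB; apply: eq_existsb => c; rewrite !scalemxAl.
by rewrite !(inj_eq (can_inj (mulmxK uB))).
Qed.

Lemma proportional_scalel (K : finFieldType) (k : K) (u v : 'rV[K]_3) :
  k != 0 -> proportional (k *: u) v -> proportional u v.
Proof.
move=> k0 /existsP[c /orP[] /eqP e]; apply/existsP.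
  by exists (k^-1 * c); rewrite -scalerA -e scalerA mulVf // scale1r eqxx.
by exists (c * k); apply/orP; right; rewrite -scalerA -e.
Qed.

(** The entries of [A] come from [F], so Frobenius fixes them. *)
Lemma conj_form_mulmx (u : 'rV[E]_3) A :
  conj_form F (u *m map_mx iota A) = conj_form F u *m map_mx iota A.
Proof.
apply/rowP=> j; rewrite !mxE !sum3E !(exprD_card iota) !mxE.
by rewrite !exprMn !(rmorph_card iota).
Qed.

Lemma double_line_pullback A a :
  A \in unitmx -> double_line a -> double_line (pullback A a).
Proof.
move=> uA /double_lineP[a0 [c [u e]]]; apply/double_lineP.
rewrite pullback_eq0 //; split=> //; exists c, (u *m A).
by rewrite e pullbackZ // pullback_line_pair.
Qed.

Lemma real_line_pair_pullback A a :
  A \in unitmx -> real_line_pair a -> real_line_pair (pullback A a).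
Proof.
move=> uA /real_line_pairP[a0 [u [v [uv e]]]]; apply/real_line_pairP.
rewrite pullback_eq0 //; split=> //; exists (u *m A), (v *m A).
by rewrite proportional_mulmx // e pullback_line_pair.
Qed.

Lemma imaginary_line_pair_pullback A a : A \in unitmx ->
  imaginary_line_pair iota a -> imaginary_line_pair iota (pullback A a).
Proof.
move=> uA /imaginary_line_pairP[a0 [c [u [uv e]]]]; apply/imaginary_line_pairP.
have two0E : 2%:R != 0 :> E by rewrite -(rmorph_nat iota) fmorph_eq0.
rewrite pullback_eq0 //; split=> //; exists c, (u *m map_mx iota A).
rewrite conj_form_mulmx proportional_mulmx ?map_unitmx //; split=> //.
by rewrite map_pullback // e pullbackZ // pullback_line_pair.
Qed.

Lemma nonsingular_conic_pullback A a :
  A \in unitmx -> nonsingular_conic a -> nonsingular_conic (pullback A a).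
Proof.
move=> uA; rewrite !nonsingular_conicE pullback_eq0 // polar_pullback //.
rewrite !det_mulmx det_tr => /andP[-> d0] /=.
by rewrite !mulf_neq0 // -?unitfE -unitmxE.
Qed.

Lemma double_lineZ c a : c != 0 -> double_line a -> double_line (c *: a).
Proof.
move=> c0 /double_lineP[a0 [k [u e]]]; apply/double_lineP.
rewrite scaler_eq0 negb_or c0 a0; split=> //; exists (c * k), u.
by rewrite e scalerA.
Qed.

Lemma real_line_pairZ c a : c != 0 -> real_line_pair a -> real_line_pair (c *: a).
Proof.
move=> c0 /real_line_pairP[a0 [u [v [uv e]]]]; apply/real_line_pairP.
rewrite scaler_eq0 negb_or c0 a0; split=> //; exists (c *: u), v.
by rewrite line_pairZl e; split=> //; apply: contra uv; apply: proportional_scalel.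
Qed.

Lemma imaginary_line_pairZ c a : c != 0 ->
  imaginary_line_pair iota a -> imaginary_line_pair iota (c *: a).
Proof.
move=> c0 /imaginary_line_pairP[a0 [k [u [uv e]]]]; apply/imaginary_line_pairP.
rewrite scaler_eq0 negb_or c0 a0; split=> //; exists (c * k), u.
by rewrite map_mxZ e rmorphM scalerA.
Qed.

Lemma nonsingular_conicZ c a :
  c != 0 -> nonsingular_conic a -> nonsingular_conic (c *: a).
Proof.
move=> c0; rewrite !nonsingular_conicE polar_mxZ detZ scaler_eq0 negb_or c0.
by move=> /andP[-> d0]; rewrite mulf_neq0 ?expf_neq0.
Qed.

End Invariance.

(** * From hyperplanes to their equations *)

Section HyperplaneCount.
Variables (F : finFieldType) (P : pred 'rV[F]_6).
Hypothesis P_neq0 : forall a, P a -> a != 0.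
Hypothesis PZ : forall c a, c != 0 -> P a -> P (c *: a).

(** The equations of one hyperplane are the nonzero multiples of any of them, and [P] is stable
    under these: each fibre has [#|F|.-1] elements. *)
Lemma num_throughE (L : {vspace 'rV[F]_6}) :
  (num_through L (hyperplanes_of P) * #|F|.-1)%N =
    #|[set a | P a & (L <= hyperplane a)%VS]|.
Proof.
set D := [set a | _ & _].
have -> : num_through L (hyperplanes_of P) = #|[set hyperplane a | a in D]|.
  apply: eq_card => H; rewrite inE; apply/andP/imsetP.
    by case=> /imsetP[a Pa ->] LH; exists a => //; rewrite inE; apply/andP.
  by case=> a; rewrite inE => /andP[Pa LH] ->; split=> //; apply: imset_f.
symmetry; apply: card_imset_fibre => a; rewrite inE => /andP[Pa LH].
have a0 := P_neq0 Pa.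
rewrite -(cardsC1 (0 : F)) -(card_imset (f := fun c => c *: a)); last first.
  by move=> c d /eqP; rewrite -subr_eq0 -scalerBl scaler_eq0 (negPf a0) orbF subr_eq0 => /eqP.
apply: eq_card => b; rewrite !inE; apply/andP/imsetP.
  case=> /andP[Pb _] /(eq_hyperplane (P_neq0 Pb) a0)[c c0 ->].
  by exists c => //; rewrite in_setC1.
case=> c; rewrite in_setC1 => c0 ->; have Pca := PZ c0 Pa.
have ab : hyperplane (c *: a) == hyperplane a.
  by apply/(eq_hyperplane (P_neq0 Pca) a0); exists c.
by rewrite ab (eqP ab) Pca LH.
Qed.

(** [pullback A] is a bijection matching the two incidence conditions; stability of [P] under [A]
    and under its inverse matches the types. *)
Lemma card_forms_image (A : 'M[F]_3) (L : {vspace 'rV[F]_6}) :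
    odd #|F| -> A \in unitmx ->
    (forall B a, B \in unitmx -> P a -> P (pullback B a)) ->
  #|[set a | P a & (K_image A L <= hyperplane a)%VS]| =
    #|[set a | P a & (L <= hyperplane a)%VS]|.
Proof.
move=> oddF uA Pinv; have two0 := natr2_neq0 oddF.
rewrite -[RHS](card_preimset _ (can_inj (pullbackK two0 uA))).
apply: eq_card => a; rewrite !inE sub_hyperplane_image //; congr (_ && _).
apply/idP/idP => [|/(Pinv (invmx A))]; first exact: Pinv.
by rewrite unitmx_inv pullbackK // => /(_ uA).
Qed.

End HyperplaneCount.

(** * Conics whose hyperplane contains [o82_line delta] *)

Lemma four_neq0 (K : fieldType) : 2%:R != 0 :> K -> 4%:R != 0 :> K.
Proof. by move=> two0; rewrite (natrM K 2 2) mulf_neq0. Qed.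

Section Orthogonal.
Variables (F : finFieldType) (delta : F).
Hypothesis oddF : odd #|F|.
Hypothesis deltaN : nonsquare delta.
Let two0 : 2%:R != 0 :> F := natr2_neq0 oddF.
Let delta0 : delta != 0 := nonsquare_neq0 deltaN.
Implicit Types (a : 'rV[F]_6) (b c d e : F).

Definition o82_conic b c d e : 'rV[F]_6 := \row_k [:: 0; b; c; delta * d; e; d]`_k.

Lemma o82_conic_coef b c d e :
  [/\ o82_conic b c d e 0 (sym_index 0 0) = 0,
      o82_conic b c d e 0 (sym_index 0 1) = b
    & o82_conic b c d e 0 (sym_index 0 2%:R) = c] /\
  [/\ o82_conic b c d e 0 (sym_index 1 1) = delta * d,
      o82_conic b c d e 0 (sym_index 1 2%:R) = e
    & o82_conic b c d e 0 (sym_index 2%:R 2%:R) = d].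
Proof. by rewrite !mxE !inordK. Qed.

Lemma o82_conic_eq0 b c d e :
  (o82_conic b c d e == 0) = [&& b == 0, c == 0, d == 0 & e == 0].
Proof.
have [[E0 E1 E2] [E3 E4 E5]] := o82_conic_coef b c d e.
apply/eqP/and4P=> [a0|[/eqP b0 /eqP c0 /eqP d0 /eqP e0]].
  by move: E1 E2 E4 E5; rewrite a0 !mxE => <- <- <- <-.
by apply: eq_sym6; rewrite (E0, E1, E2, E3, E4, E5) ?b0 ?c0 ?d0 ?e0 ?mulr0 mxE.
Qed.

(** Vanishing at the two generators of the line means that the coefficient of X0^2 is 0 and that of
    X1^2 is [delta] times that of X2^2. *)
Lemma o82_line_subP a :
  reflect (exists b c d e, a = o82_conic b c d e)
    (o82_line delta <= hyperplane a)%VS.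
Proof.
have dot y x z : sym_mx y = o82_mx delta x z ->
    \sum_k a 0 k * y 0 k = a 0 (sym_index 0 0) * x
      + (a 0 (sym_index 1 1) - delta * a 0 (sym_index 2%:R 2%:R)) * z.
  move=> /matrixP ym; rewrite sum_sym_index.
  have yE i j : y 0 (sym_index i j) = o82_mx delta x z i j by rewrite -ym mxE.
  by rewrite !yE !mxE /=; ring.
apply: (iffP (sub_hyperplaneP _ _)) => [H|[b [c [d [e ->]]]] y].
  exists (a 0 (sym_index 0 1)), (a 0 (sym_index 0 2%:R)),
    (a 0 (sym_index 2%:R 2%:R)), (a 0 (sym_index 1 2%:R)).
  have sE x z : sym_mx (sym_coord (o82_mx delta x z)) = o82_mx delta x z.
    by rewrite sym_coordK // tr_diag_mx.
  have inL x z : sym_coord (o82_mx delta x z) \in o82_line delta.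
    by apply/o82_lineP; exists x, z.
  have [[E0 E1 E2] [E3 E4 E5]] := o82_conic_coef (a 0 (sym_index 0 1))
    (a 0 (sym_index 0 2%:R)) (a 0 (sym_index 2%:R 2%:R)) (a 0 (sym_index 1 2%:R)).
  apply: eq_sym6; rewrite (E0, E1, E2, E3, E4, E5) //.
    have := H _ (inL 1 0); rewrite (dot _ _ _ (sE 1 0)).
    by rewrite mulr1 mulr0 addr0.
  have := H _ (inL 0 1); rewrite (dot _ _ _ (sE 0 1)).
  by rewrite mulr1 mulr0 add0r => /eqP; rewrite subr_eq0 => /eqP.
move=> /o82_lineP[x [z /matrixP ym]]; rewrite sum_sym_index.
have yE i j : y 0 (sym_index i j) = o82_mx delta x z i j by rewrite -ym mxE.
have [[-> -> ->] [-> -> ->]] := o82_conic_coef b c d e.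
by rewrite !yE !mxE /=; ring.
Qed.

Lemma conic_disc_o82 b c d e :
  conic_disc (o82_conic b c d e) = b * c * e - d * (b ^+ 2 + delta * c ^+ 2).
Proof.
rewrite /conic_disc.
by have [[-> -> ->] [-> -> ->]] := o82_conic_coef b c d e; ring.
Qed.

(** The missing X0^2 term forces [u 0 0 = 0]; comparing the X1^2 and X2^2 terms then exhibits
    [delta] as a square, unless the form is zero. *)
Lemma double_line_o82 b c d e : ~~ double_line (o82_conic b c d e).
Proof.
apply/negP=> /double_lineP[+ [k [u uE]]]; rewrite o82_conic_eq0.
have k0 x : k * x = 0 -> k = 0 \/ x = 0.
  by move/eqP; rewrite mulf_eq0 => /orP[]/eqP; [left|right].
have [[]] := o82_conic_coef b c d e; rewrite uE.
have sE i j : (k *: line_pair u u) 0 (sym_index i j)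
    = k * line_pair u u 0 (sym_index i j) by rewrite mxE.
rewrite !sE !line_pairE /=.
move=> u0 bE cE [deE eE dE].
have [kz|uu] := k0 _ u0.
  by rewrite -bE -cE -eE -dE kz !mul0r eqxx.
have {}uu : u 0 0 = 0 by move/eqP: uu; rewrite mulf_eq0 orbb => /eqP.
have [kz|kn] := eqVneq k 0; first by rewrite -bE -cE -eE -dE kz !mul0r eqxx.
have dd : u 0 1 * u 0 1 = delta * (u 0 2%:R * u 0 2%:R).
  by apply: (mulfI kn); rewrite deE -dE; ring.
have [u2|u2] := eqVneq (u 0 2%:R) 0.
  have u1 : u 0 1 = 0 by move/eqP: dd; rewrite u2 mulr0 mulr0 mulf_eq0 orbb => /eqP.
  by rewrite -bE -cE -eE -dE uu u1 u2 !(mul0r, mulr0, addr0) eqxx.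
case: (nonsquareP _ deltaN (u 0 1 / u 0 2%:R)).
by rewrite expr_div_n expr2 dd -expr2 mulfK // expf_neq0.
Qed.

Lemma nonsingular_o82 b c d e :
  nonsingular_conic (o82_conic b c d e) =
    (b * c * e != d * (b ^+ 2 + delta * c ^+ 2)).
Proof.
rewrite /nonsingular_conic conic_disc_o82 subr_eq0 o82_conic_eq0.
have [_|H] := eqVneq (b * c * e); rewrite ?andbF ?andbT //; apply: contraNN H.
by case/and4P=> /eqP-> /eqP-> /eqP-> /eqP->; rewrite !mul0r.
Qed.

(** With [d] nonzero, [delta] would be the square of [e / (2 d)]. *)
Lemma sqr_eq_delta d e : e ^+ 2 - 4%:R * delta * d ^+ 2 = 0 -> d = 0 /\ e = 0.
Proof.
move=> /eqP; rewrite subr_eq0 => /eqP ed.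
have d0 : d = 0.
  apply/eqP; apply: contraTT deltaN => d0; apply/negP=> /nonsquareP/(_ (e / (2%:R * d))).
  by apply; rewrite expr_div_n ed; field; rewrite d0 two0.
by split=> //; move/eqP: ed; rewrite d0 expr0n mulr0 expf_eq0 => /eqP.
Qed.

Definition vec3 (K : fieldType) (x y z : K) : 'rV[K]_3 := \row_k [:: x; y; z]`_k.

Lemma vec3Z (K : fieldType) (k x y z : K) :
  k *: vec3 x y z = vec3 (k * x) (k * y) (k * z).
Proof. by apply/rowP=> -[[|[|[|//]]] ?]; rewrite !mxE. Qed.

Lemma line_pair_vec3 (K : fieldType) (x y z x' y' z' : K) (a : 'rV[K]_6) :
    [/\ a 0 (sym_index 0 0) = x * x', a 0 (sym_index 0 1) = x * y' + y * x'
      & a 0 (sym_index 0 2%:R) = x * z' + z * x'] ->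
    [/\ a 0 (sym_index 1 1) = y * y', a 0 (sym_index 1 2%:R) = y * z' + z * y'
      & a 0 (sym_index 2%:R 2%:R) = z * z'] ->
  a = line_pair (vec3 x y z) (vec3 x' y' z').
Proof.
move=> [E0 E1 E2] [E3 E4 E5].
by apply: eq_sym6; rewrite line_pairE ![vec3 _ _ _ _ _]mxE.
Qed.

(* [X0] does not occur in an imaginary pair: its coefficient is [k u0 u0^q]. *)
Lemma imaginary_line_pair_o82 (E : finFieldType) (iota : {rmorphism F -> E}) b c d e :
    #|E| = (#|F| ^ 2)%N ->
  imaginary_line_pair iota (o82_conic b c d e) =
    [&& b == 0, c == 0 & nonsquare (e ^+ 2 - 4%:R * delta * d ^+ 2)].
Proof.
move=> cardE; have oddE : odd #|E| by rewrite cardE oddX oddF orbT.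
have [[E0 E1 E2] [E3 E4 E5]] := o82_conic_coef b c d e.
apply/imaginary_line_pairP/and3P.
  case=> a0 [k [u [uv uE]]]; set v := conj_form F u in uv uE.
  have aE i j : iota (o82_conic b c d e 0 (sym_index i j)) =
      iota k * line_pair u v 0 (sym_index i j).
    by move/rowP/(_ (sym_index i j)): uE; rewrite !mxE.
  have k0 : iota k != 0.
    apply: contraNneq a0 => kz.
    by apply/eqP/eq_sym6; apply: (fmorph_inj iota); rewrite aE kz mul0r mxE rmorph0.
  have vE i : v 0 i = u 0 i ^+ #|F| by rewrite mxE.
  have vqE i : v 0 i ^+ #|F| = u 0 i by rewrite vE exprK_card.
  have u00 : u 0 0 = 0.
    have := aE 0 0; rewrite E0 rmorph0 line_pairE /= vE -exprS => /esym/eqP.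
    by rewrite mulf_eq0 (negPf k0) expf_eq0 => /andP[_ /eqP].
  have v00 : v 0 0 = 0.
    rewrite vE u00 expr0n; have := finNzRing_gt1 F; by case: #|F|.
  have := aE 0 1; have := aE 0 2%:R; rewrite E1 E2 !line_pairE /= u00 v00.
  rewrite !(mul0r, mulr0, addr0) => /eqP; rewrite fmorph_eq0 => /eqP c0 /eqP.
  rewrite fmorph_eq0 => /eqP b0; rewrite b0 c0 eqxx; split=> //.
  (* Swapping the conjugate factors negates this minor, so Frobenius negates [iota k * s], whose
     square is the binary discriminant. *)
  set s := u 0 1 * v 0 2%:R - u 0 2%:R * v 0 1.
  have discE : iota (e ^+ 2 - 4%:R * delta * d ^+ 2) = (iota k * s) ^+ 2.
    have -> : e ^+ 2 - 4%:R * delta * d ^+ 2 = e ^+ 2 - 4%:R * (delta * d) * d by ring.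
    have := aE 1 1; have := aE 1 2%:R; have := aE 2%:R 2%:R.
    rewrite E3 E4 E5 !line_pairE /= => dE eE ddE.
    by rewrite rmorphB rmorphXn 2!rmorphM rmorph_nat eE ddE dE /s; ring.
  have sq : (iota k * s) ^+ #|F| = - (iota k * s).
    rewrite exprMn (rmorph_card iota) -mulrN; congr (_ * _).
    rewrite /s (exprD_card iota) (exprN_card iota) !exprMn !vqE -!vE; ring.
  (* A square root of the discriminant in [F] would make [iota k * s] both fixed and negated by
     Frobenius, hence zero, and the form would vanish. *)
  apply/nonsquareP=> w we; move: discE; rewrite we rmorphXn => /esym/eqP.
  rewrite eqf_sqr => tw.
  have tq : (iota k * s) ^+ #|F| = iota k * s.
    by case/orP: tw => /eqP->; rewrite ?(exprN_card iota) (rmorph_card iota).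
  have t0 : iota k * s = 0.
    apply/eqP; apply: contraT => /(oppr_neq oddE).
    by rewrite -sq tq eqxx.
  have w0 : w = 0.
    by move: tw; rewrite t0 [0 == _]eq_sym [0 == - _]eq_sym oppr_eq0 orbb fmorph_eq0 => /eqP.
  have [d0 e0] : d = 0 /\ e = 0 by apply: sqr_eq_delta; rewrite we w0 expr0n.
  by move: a0; rewrite o82_conic_eq0 b0 c0 d0 e0 eqxx.
case=> /eqP b0 /eqP c0 nN; have d0 : d != 0.
  apply: contraTneq nN => ->; apply/negP=> /nonsquareP/(_ e).
  by apply; rewrite expr0n mulr0 subr0.
have [w [w0 w2 wq]] := nonsquare_sqrt iota oddF cardE nN.
split; first by rewrite o82_conic_eq0 (negPf d0) !andbF.
have two0E : 2%:R != 0 :> E by rewrite -(rmorph_nat iota) fmorph_eq0.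
have d0E : iota d != 0 by rewrite fmorph_eq0.
(* Over [E] the form [delta d X1^2 + e X1 X2 + d X2^2] is [d] times the product of the
   [(e +- w) / (2 d) X1 + X2], which are conjugate because Frobenius negates [w]. *)
exists d, (vec3 0 ((iota e + w) / (iota (2%:R * d))) 1).
have -> : conj_form F (vec3 0 ((iota e + w) / (iota (2%:R * d))) 1) =
    vec3 0 ((iota e - w) / (iota (2%:R * d))) 1.
  apply/rowP=> i; rewrite !mxE; case: i => [[|[|[|//]]] ?] /=.
  - by rewrite expr0n; have := finNzRing_gt1 F; case: #|F|.
  - by rewrite -fmorphV exprMn (rmorph_card iota) (exprD_card iota) wq (rmorph_card iota).
  - by rewrite expr1n.
split.
  (* The last coordinates, both 1, force the proportionality factor to be 1, and then [w = - w]. *)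
  apply/negP=> /existsP[k H]; move: w0.
  suff -> : w = 0 by rewrite eqxx.
  have: (iota e + w) / iota (2%:R * d) = (iota e - w) / iota (2%:R * d).
    case/orP: H => /eqP/rowP H; have := H 1; have := H 2%:R; rewrite !mxE /= mulr1.
      by move=> <-; rewrite mul1r.
    by move=> <-; rewrite mul1r.
  have n0 : (iota (2%:R * d))^-1 != 0 by rewrite invr_neq0 // rmorphM rmorph_nat mulf_neq0.
  move=> /(mulIf n0)/addrI wN; apply/eqP; apply: contraT => /(oppr_neq oddE).
  by rewrite -wN eqxx.
rewrite -line_pairZl vec3Z rmorphM rmorph_nat.
have mE i j : map_mx iota (o82_conic b c d e) 0 (sym_index i j) =
    iota (o82_conic b c d e 0 (sym_index i j)) by rewrite mxE.
apply: line_pair_vec3; rewrite !mE !(E0, E1, E2, E3, E4, E5).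
  by rewrite b0 c0 rmorph0; split; ring.
split; last by ring.
  transitivity ((iota e ^+ 2 - w ^+ 2) / (4%:R * iota d));
    last (by field; rewrite ?d0E ?two0E ?four_neq0).
  by rewrite w2; field; rewrite d0E four_neq0.
by field; rewrite ?d0E ?two0E.
Qed.

(** The real pairs are the nonzero singular conics that are not imaginary pairs; the converse
    direction exhibits a factorisation in each case. *)
Lemma real_line_pair_o82 b c d e :
  real_line_pair (o82_conic b c d e) =
    [&& o82_conic b c d e != 0,
      b * c * e == d * (b ^+ 2 + delta * c ^+ 2) &
      ~~ [&& b == 0, c == 0 & nonsquare (e ^+ 2 - 4%:R * delta * d ^+ 2)]].
Proof.
have [[E0 E1 E2] [E3 E4 E5]] := o82_conic_coef b c d e.
apply/real_line_pairP/and3P.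
  case=> a0 [u [v [uv uE]]]; split=> //.
    have -> : d * (b ^+ 2 + delta * c ^+ 2) = d * b ^+ 2 + delta * d * c ^+ 2 by ring.
    move: E0 E1 E2 E3 E4 E5; rewrite uE !line_pairE /= => E0 <- <- <- <- <-.
    rewrite -subr_eq0; apply/eqP.
    (* The discriminant of a product of two linear forms vanishes identically; what is left here is
       the part carrying the X0^2 coefficient, which is 0. *)
    transitivity (u 0 0 * v 0 0 * (u 0 1 * v 0 2%:R - u 0 2%:R * v 0 1) ^+ 2).
      ring.
    by rewrite E0 mul0r.
  apply/negP=> /and3P[_ _ /nonsquareP].
  move=> /(_ (u 0 1 * v 0 2%:R - u 0 2%:R * v 0 1)); apply.
  have -> : 4%:R * delta * d ^+ 2 = 4%:R * (delta * d) * d by ring.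
  by move: E3 E4 E5; rewrite uE !line_pairE /= => <- <- <-; ring.
case=> a0 /eqP sing nimag; split=> //.
have nprop (y z y' z' : F) : vec3 0 y z != 0 -> ~~ proportional (vec3 0 y z) (vec3 1 y' z').
  move=> yz0; apply/negP=> /existsP[k /orP[]] /eqP H; have /rowP/(_ 0) := H; rewrite !mxE /=.
    by rewrite mulr1 => k0; move: yz0; rewrite H -k0 scale0r eqxx.
  by rewrite mulr0 => /eqP; rewrite oner_eq0.
have vec3_neq0 (y z : F) : (y != 0) || (z != 0) -> vec3 0 y z != 0.
  move=> yz0; apply/eqP=> /rowP H; move: yz0.
  by have := H 1; have := H 2%:R; rewrite !mxE /= => -> ->; rewrite eqxx.
have [b0|b0] := eqVneq b 0; last first.
  (* The factor [b X1 + c X2] is read off the terms in X0. The X1^2 and X1X2 terms determine the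
     cofactor, and singularity gives the X2^2 term. *)
  exists (vec3 0 b c), (vec3 1 (delta * d / b) ((e - c * delta * d / b) / b)).
  split; first by rewrite nprop // vec3_neq0 // b0.
  apply: line_pair_vec3; rewrite !(E0, E1, E2, E3, E4, E5); split; try by ring.
  - by field.
  - by field.
  - apply: (mulfI (expf_neq0 2 b0)).
    transitivity (b * c * e - c ^+ 2 * delta * d); last by field.
    by rewrite sing; ring.
have [c0|c0] := eqVneq c 0; last first.
  exists (vec3 0 b c), (vec3 1 (e / c) (d / c)).
  split; first by rewrite nprop // vec3_neq0 // c0 orbT.
  (* With [b = 0], singularity reads [d * (delta * c ^+ 2) = 0], and X2 splits off. *)
  have d0 : d = 0.
    have dc0 : delta * c ^+ 2 != 0 by rewrite mulf_neq0 ?expf_neq0.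
    apply/eqP; move/eqP: sing; rewrite b0 !mul0r expr0n add0r eq_sym.
    by rewrite mulf_eq0 (negPf dc0) orbF.
  apply: line_pair_vec3; rewrite !(E0, E1, E2, E3, E4, E5) ?b0 ?d0.
    by split; ring.
  by split; [ring|field|field].
(* Now [b = c = 0]: the form is binary and its discriminant is a square, so it factors over [F]. *)
have [w w2] : exists w, e ^+ 2 - 4%:R * delta * d ^+ 2 = w ^+ 2.
  move: nimag; rewrite b0 c0 !eqxx /= /nonsquare negbK => /existsP[w /eqP w2].
  by exists w.
have [d0|d0] := eqVneq d 0.
  have e0 : e != 0 by move: a0; rewrite o82_conic_eq0 b0 c0 d0 !eqxx.
  exists (vec3 0 e 0), (vec3 0 0 1); split.
    apply/negP=> /existsP[k /orP[]] /eqP/rowP H.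
      by have := H 1; rewrite !mxE /= mulr0 => /eqP; rewrite (negPf e0).
    by have := H 2%:R; rewrite !mxE /= mulr0 => /eqP; rewrite oner_eq0.
  apply: line_pair_vec3; rewrite !(E0, E1, E2, E3, E4, E5) ?b0 ?c0 ?d0.
    by split; ring.
  by split; ring.
(* A double root is excluded because the discriminant vanishes only at [d = e = 0]. *)
have w0 : w != 0.
  apply: contraNneq d0 => w0; have [] := @sqr_eq_delta d e; last by move=> ->.
  by rewrite w2 w0 expr0n.
exists (vec3 0 ((e + w) / 2%:R) d), (vec3 0 ((e - w) / (2%:R * d)) 1); split.
  apply/negP=> /existsP[k H].
  have wN : w = - w.
    apply: (@addrI _ e); apply: (mulfI (invr_neq0 two0)).
    case/orP: H => /eqP/rowP H; have := H 1; have := H 2%:R; rewrite !mxE /= => H2 H1.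
      have kd : k = d by rewrite H2 mulr1.
      by rewrite mulrC H1 kd; field; rewrite d0 two0.
    have kd : k = d^-1 by rewrite -[LHS](mulfK d0) -H2 mul1r.
    transitivity (d * (d^-1 * ((e + w) / 2%:R))); first by field; rewrite d0 two0.
    by rewrite -kd -H1; field; rewrite d0 two0.
  by move: (oppr_neq oddF w0); rewrite -wN eqxx.
apply: line_pair_vec3; rewrite !(E0, E1, E2, E3, E4, E5) ?b0 ?c0.
  by split; ring.
split; [|by field; rewrite d0 two0|by ring].
transitivity ((e ^+ 2 - w ^+ 2) / (4%:R * d));
  last (by field; rewrite ?d0 ?two0 ?four_neq0).
by rewrite -w2; field; rewrite d0 four_neq0.
Qed.

End Orthogonal.

(** * Counting *)

Lemma card_pair_set (A B : finType) (Q : pred (A * B)) :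
  #|[set t | Q t]| = (\sum_x #|[set y | Q (x, y)]|)%N.
Proof.
under eq_bigr do rewrite -sum1dep_card.
rewrite (pair_big_dep xpredT (fun x y => Q (x, y))) -sum1dep_card.
by apply: eq_bigl => -[].
Qed.

Lemma card_set_sum (T : finType) (Q : pred T) : #|[set t | Q t]| = (\sum_t Q t)%N.
Proof. by rewrite -sum1dep_card big_mkcond; apply: eq_bigr => t _; case: (Q t). Qed.

(** One coordinate is free and determines the other. *)
Lemma card_line_solutions (F : finFieldType) (r s : F) :
  (r != 0) || (s != 0) -> #|[set t : F * F | r * t.2 == t.1 * s]| = #|F|.
Proof.
have [s0|s0 _] := eqVneq s 0.
  rewrite orbF s0 => r0.
  rewrite -(card_imset predT (f := fun d => (d, 0 : F))); last by move=> d d' [].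
  apply: eq_card => -[d e]; rewrite inE /= mulr0 mulf_eq0 (negPf r0) /=.
  by apply/eqP/imsetP=> [->|[d' _ [_ ->]]] //; exists d.
rewrite -(card_imset predT (f := fun e => (r * e / s, e))); last by move=> e e' [].
apply: eq_card => -[d e]; rewrite inE /=.
apply/eqP/imsetP=> [re|[e' _ [-> ->]]]; last by rewrite divfK.
by exists e => //; rewrite re mulfK.
Qed.

Section Counts.
Variables (F : finFieldType) (delta : F).
Hypothesis oddF : odd #|F|.
Hypothesis deltaN : nonsquare delta.
Let two0 : 2%:R != 0 :> F := natr2_neq0 oddF.
Let delta0 : delta != 0 := nonsquare_neq0 deltaN.
Let q := #|F|.

Let o82_conic_of (t : (F * F) * (F * F)) : 'rV[F]_6 :=
  o82_conic delta t.1.1 t.1.2 t.2.1 t.2.2.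

Lemma card_o82_forms (P : pred 'rV[F]_6) :
  #|[set a | P a & (o82_line delta <= hyperplane a)%VS]| =
    #|[set t | P (o82_conic_of t)]|.
Proof.
rewrite -[RHS](card_imset (f := o82_conic_of)).
  apply: eq_card => a; rewrite inE; apply/andP/imsetP.
    case=> Pa /o82_line_subP[b [c [d [e aE]]]].
    by exists ((b, c), (d, e)); rewrite ?inE /o82_conic_of /= -aE.
  case=> t; rewrite inE => Pt ->; split=> //.
  by apply/o82_line_subP; exists t.1.1, t.1.2, t.2.1, t.2.2.
move=> [[b c] [d e]] [[b' c'] [d' e']]; rewrite /o82_conic_of /= => eqa.
have [[_ E1 E2] [_ E4 E5]] := o82_conic_coef delta b c d e.
have [[_ E1' E2'] [_ E4' E5']] := o82_conic_coef delta b' c' d' e'.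
by move: E1 E2 E4 E5; rewrite eqa E1' E2' E4' E5' => -> -> -> ->.
Qed.

(** For [(b, c)] nonzero, the singular conics form a line in the [(d, e)] plane, leaving [q ^ 2 - q]
    choices; for [b = c = 0] every conic is singular. *)
Lemma card_nonsingular_o82 :
  #|[set t | nonsingular_conic (o82_conic_of t)]| = ((q ^ 2 - 1) * (q ^ 2 - q))%N.
Proof.
rewrite card_pair_set (bigD1 (0, 0)) //=.
have -> : #|[set y | nonsingular_conic (o82_conic_of ((0, 0), y))]| = 0%N.
  by apply: eq_card0 => y; rewrite inE nonsingular_o82 /= !mul0r expr0n mulr0 addr0 mulr0 eqxx.
rewrite add0n (eq_bigr (fun=> q ^ 2 - q)%N) => [|[b c] bc0].
  by rewrite sum_nat_const cardC1 card_prod mulnn subn1.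
set Z := [set y : F * F | b * c * y.2 == y.1 * (b ^+ 2 + delta * c ^+ 2)].
have cZ : #|Z| = q.
  (* The line equation is nontrivial: [b * c] and [b ^+ 2 + delta * c ^+ 2] vanish together only at
     [b = c = 0]. *)
  apply: card_line_solutions; rewrite -negb_and; apply: contra bc0.
  rewrite mulf_eq0 => /andP[/orP[]/eqP-> /eqP].
    rewrite expr0n add0r => /eqP; rewrite mulf_eq0 (negPf delta0) expf_eq0 /=.
    by move=> /eqP->.
  by rewrite expr0n mulr0 addr0 => /eqP; rewrite expf_eq0 /= => /eqP->.
have <- : #|~: Z| = (q ^ 2 - q)%N.
  by rewrite -cZ cardsCs setCK card_prod cZ mulnn.
by apply: eq_card => y; rewrite !inE nonsingular_o82.
Qed.

(* [e ^+ 2 - 4 delta = w ^+ 2] exactly when [e = s + delta / s], for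
   [s = (e +- w) / 2]. *)
Lemma card_nonsquare_disc :
  #|[set e : F | nonsquare (e ^+ 2 - 4%:R * delta)]|.*2 = q.+1.
Proof.
have sqD : [set s + delta / s | s in [set~ (0 : F)]] =
    ~: [set e : F | nonsquare (e ^+ 2 - 4%:R * delta)].
  apply/setP=> e; rewrite !inE negbK; apply/imsetP/existsP.
    case=> s; rewrite in_setC1 => s0 ->; exists (s - delta / s).
    by apply/eqP; field; rewrite s0.
  case=> w /eqP ew; have prod : (e + w) / 2%:R * ((e - w) / 2%:R) = delta.
    transitivity ((e ^+ 2 - w ^+ 2) / 4%:R); first by field; rewrite two0 four_neq0.
    by rewrite -ew; field; rewrite four_neq0.
  have s0 : (e + w) / 2%:R != 0.
    by apply: contraNneq delta0 => s0; rewrite -prod s0 mul0r.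
  exists ((e + w) / 2%:R); first by rewrite in_setC1.
  by rewrite -{1}prod mulrAC divff // mul1r; field; rewrite two0.
have := @card_imset_fibre F F (fun s => s + delta / s) [set~ 0] 2.
rewrite cardsC1 sqD => H.
have /H{H} : {in [set~ (0 : F)], forall s,
    #|[set y in [set~ 0] | y + delta / y == s + delta / s]| = 2}.
  move=> s; rewrite in_setC1 => s0.
  (* The fibre through [s] is [{s, delta / s}]; equality of the two would give [delta = s ^+ 2]. *)
  have ds : s != delta / s.
    apply: contraTneq deltaN => sE; apply/negP=> /nonsquareP/(_ s); apply.
    by rewrite expr2 {2}sE mulrC divfK.
  transitivity #|[set s; delta / s]|; last by rewrite cards2 ds.
  apply: eq_card => y; rewrite !inE; have [->|y0] := eqVneq y 0.
    by rewrite /= ![0 == _]eq_sym mulf_eq0 invr_eq0 (negPf s0) (negPf delta0).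
  have -> : (y + delta / y == s + delta / s) = ((y - s) * (y - delta / s) == 0).
    rewrite -subr_eq0 -(inj_eq (mulIf y0)) mul0r; congr (_ == _).
    by field; rewrite s0 y0.
  by rewrite mulf_eq0 !subr_eq0.
(* The complement has [(q - 1) / 2] elements, which leaves [(q + 1) / 2]. *)
have := cardsC [set e : F | nonsquare (e ^+ 2 - 4%:R * delta)].
have := finNzRing_gt1 F; rewrite -/q; lia.
Qed.

Lemma nonsquareZ (d n : F) : d != 0 -> nonsquare (d ^+ 2 * n) = nonsquare n.
Proof.
move=> d0; apply/nonsquareP/nonsquareP => H w E.
  by apply: (H (d * w)); rewrite E exprMn.
by apply: (H (w / d)); rewrite expr_div_n -E mulrC mulKf ?expf_neq0.
Qed.

(** Only [b = c = 0] contributes. There [d = 0] gives the square discriminant [e ^+ 2], and for each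
    other [d] the substitution [e = d * e'] reduces to [d = 1]. *)
Lemma card_imaginary_o82 (E : finFieldType) (iota : {rmorphism F -> E}) :
    #|E| = (q ^ 2)%N ->
  (#|[set t | imaginary_line_pair iota (o82_conic_of t)]|.*2 = q.-1 * q.+1)%N.
Proof.
move=> cardE; rewrite card_pair_set (bigD1 (0, 0)) //= big1 => [|[b c] bc0].
  rewrite addn0 card_pair_set (bigD1 0) //=.
  rewrite [X in (X + _)%N]eq_card0 => [|e]; last first.
    rewrite inE imaginary_line_pair_o82 // !eqxx /= expr0n mulr0 subr0.
    by case: nonsquareP => // /(_ e).
  rewrite add0n -card_nonsquare_disc -muln2 -[in RHS]muln2 mulnA; congr (_ * _)%N.
  rewrite -(cardC1 (0 : F)) -sum_nat_const; apply: eq_bigr => d d0.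
  rewrite -[RHS](card_imset _ (mulfI d0)).
  apply: eq_card => e; rewrite inE imaginary_line_pair_o82 // !eqxx /=.
  have -> : e ^+ 2 - 4%:R * delta * d ^+ 2 = d ^+ 2 * ((e / d) ^+ 2 - 4%:R * delta).
    by field.
  rewrite nonsquareZ //; apply/idP/imsetP=> [H|[e' + ->]].
    by exists (e / d); rewrite ?inE // mulrC divfK.
  by rewrite inE [d * e']mulrC mulfK.
apply: eq_card0 => y; rewrite inE imaginary_line_pair_o82 //=.
by apply: contraNF bc0 => /and3P[/eqP-> /eqP->].
Qed.

(** The zero form, the non-singular conics, the imaginary pairs and the real pairs partition the
    [q ^ 4] parameter quadruples. *)
Lemma card_real_o82 (E : finFieldType) (iota : {rmorphism F -> E}) :
    #|E| = (q ^ 2)%N ->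
  (#|[set t | real_line_pair (o82_conic_of t)]|
   + #|[set t | nonsingular_conic (o82_conic_of t)]|
   + #|[set t | imaginary_line_pair iota (o82_conic_of t)]| + 1 = q ^ 4)%N.
Proof.
move=> cardE.
have card0 : #|[set t | o82_conic_of t == 0]| = 1%N.
  transitivity #|[set (((0, 0), (0, 0)) : (F * F) * (F * F))]|; last exact: cards1.
  apply: eq_card.
  by move=> [[b c] [d e]]; rewrite !inE o82_conic_eq0 !xpair_eqE -!andbA.
have <- : #|{: (F * F) * (F * F)}| = (q ^ 4)%N by rewrite !card_prod -/q; lia.
rewrite -[X in (_ + X)%N = _]card0 !card_set_sum -!big_split -sum1_card.
(* Pointwise, exactly one of the four indicators equals 1. *)
apply: eq_bigr => -[[b c] [d e]] _.
rewrite /o82_conic_of /= real_line_pair_o82 // nonsingular_o82 //.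
rewrite imaginary_line_pair_o82 //.
case: eqVneq => [/eqP|_] /=.
  rewrite o82_conic_eq0 => /and4P[/eqP-> /eqP-> /eqP-> /eqP->].
  rewrite !mul0r !expr0n !mulr0 subrr !eqxx /=.
  by case: nonsquareP => // /(_ 0); rewrite expr0n.
case: (altP (b * c * e =P _)) => [_|ns] /=; first by case: (X in ~~ X).
suff -> : [&& b == 0, c == 0 & nonsquare (e ^+ 2 - 4%:R * delta * d ^+ 2)] = false by [].
apply: contraNF ns => /and3P[/eqP-> /eqP-> _].
by rewrite !mul0r expr0n mulr0 addr0 mulr0.
Qed.

End Counts.

(** * Arithmetic of the counts and conclusion *)

Lemma nonsingular_count_identity (q : nat) :
  ((q ^ 2 - 1) * (q ^ 2 - q) = (q ^ 3 - q) * q.-1)%N.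
Proof.
case: q => [|m] //.
have -> : (m.+1 ^ 2 - 1 = m * m.+2)%N by rewrite expnS expn1; lia.
have -> : (m.+1 ^ 2 - m.+1 = m * m.+1)%N by rewrite expnS expn1; lia.
have -> : (m.+1 ^ 3 - m.+1 = m * m.+1 * m.+2)%N by rewrite !expnS expn0; lia.
rewrite /=; lia.
Qed.

Lemma real_count_identity (q r : nat) : odd q -> (1 < q)%N ->
    (r * q.-1 + (q ^ 3 - q) * q.-1 + (q + 1) %/ 2 * q.-1 + 1 = q ^ 4)%N ->
  (r = q ^ 2 + (3 * q + 1) %/ 2)%N.
Proof.
(* Writing [q = 2 k + 1] removes the divisions by 2, and the common factor [q - 1 = 2 k] can then be
   cancelled. *)
move=> oddq; have [k ->] : exists k, q = k.*2.+1.
  by exists q./2; rewrite -[LHS]odd_double_half oddq.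
have -> : ((k.*2.+1 + 1) %/ 2 = k.+1)%N by lia.
have -> : ((3 * k.*2.+1 + 1) %/ 2 = 3 * k + 2)%N by lia.
have -> : (k.*2.+1 ^ 3 - k.*2.+1 = k.*2 * k.*2.+1 * k.*2.+2)%N.
  by rewrite !expnS expn0; lia.
rewrite !expnS expn0 /= => k0 sum.
by apply/eqP; rewrite -(eqn_pmul2r (m := k.*2)); [apply/eqP; lia | lia].
Qed.

Theorem lemma4p5 (q : nat) (F : finFieldType) (cardF : #|F| = q)
    (odd_q : odd q)
    (E : finFieldType) (iota : {rmorphism F -> E}) (cardE : #|E| = (q ^ 2)%N)
    (delta : F) (delta_nonsquare : nonsquare delta)
    (L : {vspace 'rV[F]_6}) (line_L : \dim L = 2%N)
    (L_o82 : L \in o82 delta) :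
  OD4 iota L =
    [:: 0; q ^ 2 + (3 * q + 1) %/ 2; (q + 1) %/ 2; q ^ 3 - q]%N.
Proof.
have q_gt1 : (1 < q)%N by rewrite -cardF finNzRing_gt1.
have oddF : odd #|F| by rewrite cardF.
have cardEF : #|E| = (#|F| ^ 2)%N by rewrite cardF.
case/imsetP: L_o82 => A; rewrite inE => uA LA.
(* For each invariant type, the number of hyperplanes times [q - 1] becomes a number of quadruples
   [(b, c, d, e)] for the standard line. *)
have count (P : pred 'rV[F]_6) : (forall a, P a -> a != 0) ->
    (forall c a, c != 0 -> P a -> P (c *: a)) ->
    (forall B a, B \in unitmx -> P a -> P (pullback B a)) ->
    (num_through L (hyperplanes_of P) * q.-1)%N =
      #|[set t : (F * F) * (F * F) | P (o82_conic delta t.1.1 t.1.2 t.2.1 t.2.2)]|.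
  move=> P0 PZ Ppull; rewrite -cardF num_throughE // LA card_forms_image //.
  exact: card_o82_forms.
have cD := count (@double_line F) (fun a H => proj1 (andP H))
  (@double_lineZ F) (@double_line_pullback F oddF).
have nD : num_through L (hyperplanes_of (@double_line F)) = 0%N.
  apply/eqP; rewrite -(eqn_pmul2r (m := q.-1)) ?mul0n; last by lia.
  by rewrite cD eq_card0 // => t; rewrite inE; apply/negbTE/double_line_o82.
have cN := count (@nonsingular_conic F) (fun a H => proj1 (andP H))
  (@nonsingular_conicZ F oddF) (@nonsingular_conic_pullback F oddF).
have cI := count (imaginary_line_pair iota) (fun a H => proj1 (andP H))
  (@imaginary_line_pairZ F E iota) (@imaginary_line_pair_pullback F E iota oddF).
have cR := count (@real_line_pair F) (fun a H => proj1 (andP H))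
  (@real_line_pairZ F) (@real_line_pair_pullback F oddF).
have nN : num_through L (hyperplanes_of (@nonsingular_conic F)) = (q ^ 3 - q)%N.
  apply/eqP; rewrite -(eqn_pmul2r (m := q.-1)); last by lia.
  by rewrite cN card_nonsingular_o82 // cardF nonsingular_count_identity.
have nI : num_through L (hyperplanes_of (imaginary_line_pair iota)) = ((q + 1) %/ 2)%N.
  have := card_imaginary_o82 oddF delta_nonsquare iota cardEF.
  rewrite -cI cardF => /eqP; rewrite -muln2 mulnAC mulnC eqn_pmul2l; last by lia.
  by move=> /eqP; lia.
have nR : num_through L (hyperplanes_of (@real_line_pair F)) =
    (q ^ 2 + (3 * q + 1) %/ 2)%N.
  (* Real pairs are obtained by subtracting the other types from [q ^ 4]. *)
  have := card_real_o82 oddF delta_nonsquare iota cardEF.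
  by rewrite -cR -cN -cI nN nI cardF; apply: real_count_identity.
by rewrite /OD4 nD nR nI nN.
Qed.
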